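(* Let $P\in\mathcal{P}^{n\times m}$ be a causal plant, and let $\mathfrak{t}=\sum_{I\in\mathcal{I}}(t_I)$ be its full-size minor ideal (formed from any fractional representation $P=ND^{-1}$ with $N\in\mathcal{A}^{n\times m}$, $D\in\mathcal{A}^{m\times m}$, $D$ nonsingular). Then $P$ is stabilizable if and only if the ideal $\mathfrak{t}$ is projective as an $\mathcal{A}$-module. Further, when $\mathfrak{t}$ is projective, it is of rank $1$.
   Context: $\mathcal{A}$ is a commutative ring with $1\neq 0$ (the set of stable causal transfer functions), and $\mathcal{F}=\{a/b : a,b\in\mathcal{A},\ b \text{ a nonzerodivisor}\}$ is its total ring of fractions. $\mathcal{Z}$ is a fixed prime ideal of $\mathcal{A}$, $\mathcal{Z}\neq\mathcal{A}$, containing all zerodivisors of $\mathcal{A}$. $\mathcal{P}=\{a/b\in\mathcal{F} : a\in\mathcal{A},\ b\in\mathcal{A}\setminus\mathcal{Z}\}$ is the set of causal transfer functions; a matrix is causal if all its entries lie in $\mathcal{P}$. $m,n$ are positive integers, and a plant is a matrix $P\in\mathcal{F}^{n\times m}$. Stabilizability: for $C\in\mathcal{F}^{m\times n}$ such that $\det(E_n+PC)$ is a nonzerodivisor of $\mathcal{F}$ (i.e. a unit of $\mathcal F$), put $$H(P,C)=\begin{bmatrix}(E_n+PC)^{-1} & -P(E_m+CP)^{-1}\\ C(E_n+PC)^{-1} & (E_m+CP)^{-1}\end{bmatrix}\in\mathcal{F}^{(m+n)\times(m+n)},$$ where $E_k$ is the $k\times k$ identity matrix. $P$ is stabilizable if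 there is such a $C$ with all entries of $H(P,C)$ in $\mathcal{A}$. Full-size minor ideal: a square matrix over $\mathcal{A}$ is nonsingular if its determinant is a nonzerodivisor. Every $P\in\mathcal{F}^{n\times m}$ can be written $P=ND^{-1}$ with $N\in\mathcal{A}^{n\times m}$, $D\in\mathcal{A}^{m\times m}$ nonsingular. Let $T=\begin{bmatrix}N\\ D\end{bmatrix}\in\mathcal{A}^{(m+n)\times m}$. $\mathcal{I}$ is the family of all $m$-element subsets of $\{1,\dots,m+n\}$; for $I=\{i_1<\dots<i_m\}\in\mathcal{I}$, $\Delta_I$ is the $m\times(m+n)$ matrix whose $(k,i_k)$-entries are $1$ and whose other entries are $0$, and $t_I=\det(\Delta_I T)$. The full-size minor ideal of $P$ is the ideal $\mathfrak{t}=\sum_{I\in\mathcal{I}}(t_I)$ of $\mathcal{A}$. As an $\mathcal{A}$-module it is independent, up to isomorphism, of the choice of $N,D$. A finitely generated projective module is of rank $1$ if its localization at every prime ideal is free of rank $1$. *)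

(* Defs.v *)
From HB Require Import structures.
From mathcomp Require Import all_boot all_order all_algebra.
From mathcomp Require Import boolp.

Set Implicit Arguments.
Unset Strict Implicit.
Unset Printing Implicit Defensive.

Import GRing.Theory.
Local Open Scope ring_scope.

(** * Localization *)

(* [B], together with [iota], is the localization of [A] at the multiplicative
   set [S]; this determines [(B, iota)] up to a unique isomorphism. *)
Definition is_localization (A : comNzRingType) (S : A -> Prop)
    (B : comUnitRingType) (iota : {rmorphism A -> B}) : Prop :=
  [/\ forall s, S s -> iota s \is a GRing.unit,
      forall b, exists a s, S s /\ b = iota a / iota s
    & forall a, iota a = 0 -> exists s, S s /\ s * a = 0].

(* [GRing.lreg a] says that [a] is a nonzerodivisor.  The third clause of
   [is_localization] then makes [iota] injective. *)
Definition is_total_fraction_ring (A : comNzRingType) (F : comUnitRingType)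
    (iota : {rmorphism A -> F}) : Prop :=
  is_localization (fun a : A => GRing.lreg a) iota.

(* [L], together with [f], is the localization at [S] of the [A]-module [M],
   as a module over the localization [(B, iota)] of [A] at [S]. *)
Definition is_localized_module (A : comNzRingType) (S : A -> Prop)
    (B : comUnitRingType) (iota : {rmorphism A -> B})
    (M : lmodType A) (L : lmodType B) (f : {linear M -> L | iota \; *:%R}) :
    Prop :=
  (forall l : L, exists v s, S s /\ l = (iota s)^-1 *: f v)
  /\ (forall v : M, f v = 0 -> exists s, S s /\ s *: v = 0).

(** * Projective modules and their rank *)

Definition projective (A : comNzRingType) (M : lmodType A) : Prop :=
  forall (X Y : lmodType A) (g : {linear X -> Y}) (f : {linear M -> Y}),
    (forall y : Y, exists x : X, g x = y) ->
    exists h : {linear M -> X}, forall v : M, g (h v) = f v.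

Definition free_of_rank (A : comNzRingType) (r : nat) (M : lmodType A) : Prop :=
  exists f : {linear 'rV[A]_r -> M}, bijective f.

(* Localizations being unique up to isomorphism, it does not matter which
   model of the localized ring and module is used; we ask for all of them. *)
Definition of_rank1 (A : comNzRingType) (M : lmodType A) : Prop :=
  forall (p : prime_idealr A)
    (B : comUnitRingType) (iota : {rmorphism A -> B})
    (L : lmodType B) (f : {linear M -> L | iota \; *:%R}),
    is_localization (fun s : A => s \notin p) iota ->
    is_localized_module (fun s : A => s \notin p) f ->
    free_of_rank 1 L.

(** * Plants *)

Section Plants.

Variables (A : comNzRingType) (F : comUnitRingType) (iota : {rmorphism A -> F}).

Definition causal (Z : prime_idealr A) (x : F) : Prop :=
  exists a b : A, b \notin Z /\ x = iota a / iota b.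

Definition causal_mx (Z : prime_idealr A) n m (P : 'M[F]_(n, m)) : Prop :=
  forall i j, causal Z (P i j).

Definition closed_loop n m (P : 'M[F]_(n, m)) (C : 'M[F]_(m, n)) :
    'M[F]_(n + m) :=
  block_mx (invmx (1%:M + P *m C)) (- (P *m invmx (1%:M + C *m P)))
           (C *m invmx (1%:M + P *m C)) (invmx (1%:M + C *m P)).

Definition stabilizable n m (P : 'M[F]_(n, m)) : Prop :=
  exists C : 'M[F]_(m, n),
    1%:M + P *m C \in unitmx /\
    forall i j, exists a : A, closed_loop P C i j = iota a.

Definition fractional_representation n m (P : 'M[F]_(n, m))
    (N : 'M[A]_(n, m)) (D : 'M[A]_m) : Prop :=
  GRing.lreg (\det D) /\ P = map_mx iota N *m invmx (map_mx iota D).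

End Plants.

(** * The full-size minor ideal, as a submodule of the regular module [A^o] *)

Section FullSizeMinors.

Variables (A : comNzRingType) (n m : nat) (T : 'M[A]_(n + m, m)).

(* [enum I] lists [I] in increasing order, so row [k] has its unique 1 in
   column [i_k]. *)
Definition Delta (I : {set 'I_(n + m)}) : 'M[A]_(m, n + m) :=
  \matrix_(k, j) (onth (enum I) k == Some j)%:R.

Definition full_size_minor (I : {set 'I_(n + m)}) : A := \det (Delta I *m T).

Definition minor_ideal : {pred A^o} := fun x : A^o =>
  `[< exists c : {set 'I_(n + m)} -> A,
        x = \sum_(I : {set 'I_(n + m)} | #|I| == m) c I * full_size_minor I >].

Fact minor_ideal_submod_closed : submod_closed minor_ideal.
Proof.
split.
  apply/asboolP; exists (fun=> 0).
  by rewrite big1 // => I _; rewrite mul0r.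
move=> a x y /asboolP[c ->] /asboolP[d ->]; apply/asboolP.
exists (fun I => a * c I + d I).
rewrite /GRing.scale/= mulr_sumr -big_split/=; apply: eq_bigr => I _.
by rewrite mulrDl mulrA.
Qed.

HB.instance Definition _ :=
  GRing.isSubmodClosed.Build A A^o minor_ideal minor_ideal_submod_closed.

Record minor_ideal_module : Type :=
  MinorIdealElt { minor_val :> A^o; _ : minor_val \in minor_ideal }.

HB.instance Definition _ := [isSub for minor_val].
HB.instance Definition _ := [Choice of minor_ideal_module by <:].
HB.instance Definition _ :=
  [SubChoice_isSubLmodule of minor_ideal_module by <:].

End FullSizeMinors.

(* Main.v *)
From HB Require Import structures.
Require Import Defs.
From mathcomp Require Import all_boot all_order all_algebra.
From mathcomp Require Import all_fingroup boolp.

Set Implicit Arguments.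
Unset Strict Implicit.
Unset Printing Implicit Defensive.

Import GRing.Theory.
Local Open Scope ring_scope.

(** Both sides of the equivalence are turned into statements about the matrix
    [T = col_mx N D], viewed over [F].

    On the module side, the ideal [t] of full-size minors contains the regular
    element [\det D], so that the dual basis lemma ([projective_dual_basis],
    [dual_basis_projective]) says that [t] is projective exactly when it is
    invertible: there are [x_I] in [F] with [x_I t] inside [A] and
    [\sum_I x_I t_I = 1].

    On the control side, put [U = (1 + CP)^-1] and [V = U C].  The blocks of
    the closed loop are then [1 - PV], [-PU], [V] and [U], and [U + VP = 1].
    So [P] is stabilizable iff such [U], [V] exist with [U], [V], [PU], [PV]
    over [A] and with [U] invertible over [F] ([stabilizableP]).  Without the
    last condition, the substitution [Y = D^-1 [V U]] turns this into the
    existence of a left inverse [Y] of [T] such that [T Y] has entries in [A]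
    ([integral_factor_left_inverse]).

    Such a [Y] exists iff [t] is invertible.  Given [Y], the maximal minors of
    [Y] serve as the [x_I]: the Cauchy-Binet formula ([Cauchy_Binet]) applied
    to [Y T = 1] gives [\sum_I x_I t_I = 1], and [x_I t_J] is a minor of [T Y],
    hence lies in [A].  Given the [x_I], take for [Y] the combination with
    coefficients [x_I] of the adjugates of the [m]-rowed submatrices of [T];
    by Cramer's rule the entries of [T] times such an adjugate lie in [t]
    ([mulmx_adj_rowsub_in]), so [x_I] multiplies them into [A].

    Causality serves to make [U] invertible.  If [b] outside [Z] is a common
    denominator of [P], then for every matrix [Q] over [A] one may replace
    [(U, V)] by [(U + bQ(1 - U), V - bQV)].  A diagonal [Q] can be chosen row
    by row so that the new determinant stays outside [Z] ([avoid_prime_det]),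
    and elements outside [Z] are nonzerodivisors.

    Finally, [\sum_I x_I t_I = 1] forces [x_I t_I] outside any given prime [p]
    for some [I], and then [t_I] alone generates [t] at [p], freely
    ([dual_basis_rank1]). *)

(** * Maximal minors and the Cauchy-Binet formula *)

Section RowSelection.

Variables (n m : nat).
Implicit Types (I : {set 'I_(n + m)}) (f : 'I_m -> 'I_(n + m)).

(** The increasing enumeration of [I].  The default value of [nth], an
    arbitrary element of the target, only occurs when [#|I| < m]. *)
Definition select I (k : 'I_m) : 'I_(n + m) := nth (rshift n k) (enum I) k.

Lemma onth_select I (k : 'I_m) : #|I| = m ->
  onth (enum I) k = Some (select I k).
Proof.
move=> cardI; rewrite onthE (nth_map (rshift n k)) //.
by rewrite -cardE cardI.
Qed.

Lemma select_inj I : #|I| = m -> injective (select I).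
Proof.
move=> cardI k l; have sz : size (enum I) = m by rewrite -cardE.
rewrite /select (set_nth_default (rshift n k) (rshift n l)) ?sz // => /eqP.
by rewrite nth_uniq ?sz ?enum_uniq // => /eqP/val_inj.
Qed.

Lemma select_image I : #|I| = m -> select I @: setT = I.
Proof.
move=> cardI; apply/eqP; rewrite eqEcard.
rewrite card_imset; last exact: select_inj.
rewrite cardsT card_ord cardI leqnn andbT.
apply/subsetP=> _ /imsetP[k _ ->]; rewrite -mem_enum mem_nth //.
by rewrite -cardE cardI.
Qed.

(** An injective choice of rows is an increasing one followed by a permutation;
    hence the minors [t_I] account, up to sign, for all choices of rows. *)
Lemma injective_select f : injective f ->
  exists s : 'S_m, f =1 select (f @: setT) \o s.
Proof.
move=> f_inj; set I := f @: setT.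
have cardI : #|I| = m by rewrite card_imset // cardsT card_ord.
have pre k : exists l, f k == select I l.
  have : f k \in select I @: setT by rewrite select_image ?imset_f.
  by case/imsetP=> l _ ->; exists l.
pose g k := xchoose (pre k).
have gP k : f k = select I (g k) by apply/eqP/(xchooseP (pre k)).
have g_inj : injective g by move=> k l gkl; apply: f_inj; rewrite !gP gkl.
by exists (perm g_inj) => k /=; rewrite permE gP.
Qed.

Variable R : comNzRingType.
Implicit Types (T : 'M[R]_(n + m, m)) (Y : 'M[R]_(m, n + m)).

Lemma Delta_rowsub I : #|I| = m -> Delta R I = rowsub (select I) 1%:M.
Proof.
by move=> cardI; apply/matrixP=> k j; rewrite !mxE onth_select.
Qed.

Lemma Delta_mul T I : #|I| = m -> Delta R I *m T = rowsub (select I) T.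
Proof. by move=> cardI; rewrite Delta_rowsub // -rowsubE. Qed.

Lemma mul_Delta_tr Y I : #|I| = m -> Y *m (Delta R I)^T = colsub (select I) Y.
Proof.
move=> cardI; apply: trmx_inj.
by rewrite trmx_mul trmxK Delta_rowsub // -rowsubE trmx_mxsub.
Qed.

Lemma det_rowsub_perm T f (s : 'S_m) :
  \det (rowsub (f \o s) T) = (-1) ^+ s * \det (rowsub f T).
Proof.
have -> : rowsub (f \o s) T = row_perm s (rowsub f T).
  by apply/matrixP=> i j; rewrite !mxE.
by rewrite row_permE det_mulmx det_perm.
Qed.

Lemma det_rowsub_noninj T f : ~ injective f -> \det (rowsub f T) = 0.
Proof.
move=> /injectiveP/injectivePn[i [j neq_ij eq_f]].
by apply: (determinant_alternate neq_ij) => k; rewrite !mxE eq_f.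
Qed.

Lemma full_size_minorE T I : #|I| = m ->
  full_size_minor T I = \det (rowsub (select I) T).
Proof. by move=> cardI; rewrite /full_size_minor Delta_mul. Qed.

Lemma full_size_minor_in T I : #|I| = m ->
  full_size_minor T I \in minor_ideal T.
Proof.
move=> cardI; apply/asboolP; exists (fun J => (J == I)%:R).
rewrite (bigD1 I) ?cardI //= eqxx mul1r big1 ?addr0 // => J /andP[_ /negPf->].
by rewrite mul0r.
Qed.

Lemma det_rowsub_in T f : \det (rowsub f T) \in minor_ideal T.
Proof.
have [f_inj | not_inj] := pselect (injective f); last first.
  by rewrite det_rowsub_noninj // rpred0.
have cardI : #|f @: setT| = m by rewrite card_imset // cardsT card_ord.
have [s fE] := injective_select f_inj.
have -> : rowsub f T = rowsub (select (f @: setT) \o s) T by apply: eq_rowsub.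
rewrite det_rowsub_perm -full_size_minorE //.
exact: (@rpredZ _ _ (minor_ideal T) _ (full_size_minor T _)
          (full_size_minor_in T cardI)).
Qed.

(** Cramer's rule: the entry is the determinant obtained by replacing row [k]
    of the submatrix by row [i] of [T], again a minor of [T]. *)
Lemma mulmx_adj_rowsub_in T f i k :
  (T *m \adj (rowsub f T)) i k \in minor_ideal T.
Proof.
pose g l := if l == k then i else f l.
suff -> : (T *m \adj (rowsub f T)) i k = \det (rowsub g T).
  exact: det_rowsub_in.
rewrite (expand_det_row _ k) !mxE; apply: eq_bigr => j _.
rewrite !mxE /g eqxx; congr (_ * (_ * \det _)); apply/matrixP=> a b.
by rewrite !mxE eq_sym (negPf (neq_lift k a)).
Qed.

(** Multilinear expansion in the rows of the product; the rectangular version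
    of the first step towards the multiplicativity of [\det]. *)
Lemma det_mulmx_functions T Y :
  \det (Y *m T) =
  \sum_(f : {ffun 'I_m -> 'I_(n + m)})
     (\prod_i Y i (f i)) * \det (rowsub f T).
Proof.
transitivity (\sum_(s : 'S_m) \sum_(f : {ffun 'I_m -> 'I_(n + m)})
    (-1) ^+ s * \prod_i (Y i (f i) * T (f i) (s i))).
  apply: eq_bigr => s _; rewrite -big_distrr /=; congr (_ * _).
  rewrite -(bigA_distr_bigA (fun i j => Y i j * T j (s i))) /=.
  by apply: eq_bigr => i _; rewrite mxE.
rewrite exchange_big; apply: eq_bigr => f _ /=.
rewrite big_distrr; apply: eq_bigr => s _ /=.
rewrite big_split /= mulrCA; congr (_ * (_ * _)).
by apply: eq_bigr => i _; rewrite mxE.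
Qed.

(** In the expansion over all choices of rows only the injective ones survive.
    Those with image [I] differ by a permutation, whose sign rebuilds the
    determinant of the columns of [Y] in [I]. *)
Lemma Cauchy_Binet T Y :
  \det (Y *m T) =
  \sum_(I : {set 'I_(n + m)} | #|I| == m)
     \det (Y *m (Delta R I)^T) * full_size_minor T I.
Proof.
rewrite det_mulmx_functions.
rewrite (bigID (fun f : {ffun _} => injectiveb f)) /= addrC big1 ?add0r => [|f];
  last by move/injectiveP=> not_inj; rewrite det_rowsub_noninj // mulr0.
rewrite (partition_big (fun f : {ffun _} => f @: setT)
          (fun I => #|I| == m)) /= => [|f /injectiveP f_inj]; last first.
  by rewrite card_imset // cardsT card_ord.
apply: eq_bigr => I /eqP cardI.
pose h (s : 'S_m) := [ffun i => select I (s i)].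
have h_inj : injective h.
  move=> s t /ffunP st; apply/permP=> i; have := st i; rewrite !ffunE.
  exact: select_inj.
(* The injective [f] with image [I] are the [select I \o s], one for each
   [s]. *)
transitivity (\sum_(f in h @: setT) (\prod_i Y i (f i)) * \det (rowsub f T)).
  apply: eq_bigl => f; apply/andP/imsetP => [[/injectiveP f_inj /eqP fI] | ].
    have [s fs] := injective_select f_inj.
    by exists s => //; apply/ffunP=> i; rewrite ffunE fs fI.
  case=> s _ ->; split.
    apply/injectiveP=> i j; rewrite !ffunE => /(select_inj cardI).
    exact: perm_inj.
  rewrite -[X in _ == X](select_image cardI); apply/eqP/setP=> j.
  apply/imsetP/imsetP=> -[k _ ->]; first by exists (s k); rewrite ?ffunE.
  by exists ((s^-1)%g k); rewrite // ffunE permKV.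
rewrite big_imset /=; last by move=> s t _ _; apply: h_inj.
rewrite mul_Delta_tr // full_size_minorE // /(\det (colsub _ _)) big_distrl /=.
apply: eq_big => [s | s _]; first by rewrite inE.
have -> : rowsub (h s) T = rowsub (select I \o s) T.
  by apply: eq_rowsub => i /=; rewrite ffunE.
rewrite det_rowsub_perm mulrA; congr (_ * _); rewrite mulrC; congr (_ * _).
by apply: eq_bigr => i _; rewrite !mxE ffunE.
Qed.

End RowSelection.

(** * Projectivity of the ideal of minors through dual bases *)

Lemma linear_funP (R : pzRingType) (U V : lmodType R) (f : U -> V) :
  linear f -> exists g : {linear U -> V}, g =1 f.
Proof.
move=> f_lin.
pose g : {linear U -> V} := HB.pack f (GRing.isLinear.Build _ _ _ _ f f_lin).
by exists g.
Qed.

Section DualBasis.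

Variables (A : comNzRingType) (n m : nat) (T : 'M[A]_(n + m, m)).

Local Notation M := (minor_ideal_module T).
Local Notation index := {set 'I_(n + m)}.

(** Elements outside the ideal go to [0]; being total, this map lets families
    of generators be indexed by all sets [I]. *)
Definition in_minor_ideal (a : A) : M := insubd (0 : M) (a : A^o).

Lemma in_minor_idealK (a : A) :
  a \in minor_ideal T -> minor_val (in_minor_ideal a) = a.
Proof. by move=> aT; rewrite -[LHS]/(val _) insubdK. Qed.

Definition minor_elt (I : index) : M := in_minor_ideal (full_size_minor T I).

Lemma minor_eltK (I : index) : #|I| = m ->
  minor_val (minor_elt I) = full_size_minor T I.
Proof. by move=> cardI; rewrite in_minor_idealK // full_size_minor_in. Qed.

Lemma minor_valD (u v : M) : minor_val (u + v) = minor_val u + minor_val v.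
Proof. exact: (raddfD (val : M -> A^o)). Qed.

Lemma minor_valZ a (v : M) : minor_val (a *: v) = a * minor_val v :> A.
Proof. exact: (linearZ_LR (val : M -> A^o)). Qed.

Lemma minor_val_sum (P : pred index) (F : index -> M) :
  minor_val (\sum_(I | P I) F I) = \sum_(I | P I) minor_val (F I) :> A.
Proof. exact: (raddf_sum (val : M -> A^o)). Qed.

Lemma minor_ideal_spanP (v : M) : exists c : index -> A,
  v = \sum_(I : index | #|I| == m) c I *: minor_elt I.
Proof.
case: v => v vT; case/asboolP: (vT) => c vE; exists c; apply: val_inj => /=.
rewrite minor_val_sum vE; apply: eq_bigr => I /eqP cardI.
by rewrite minor_valZ minor_eltK.
Qed.

(** The coordinate forms of a dual basis for the generators [t_I]: these split
    the surjection from the free module on the [t_I] onto the ideal. *)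
Definition dual_basis (phi : index -> M -> A) : Prop :=
  (forall I, scalar (phi I)) /\
  (forall v, v = \sum_(I : index | #|I| == m) phi I v *: minor_elt I).

Lemma scalar_funZ (f : M -> A) a u : scalar f -> f (a *: u) = a * f u.
Proof.
move=> f_lin; have f0 : f 0 = 0.
  by have := f_lin (-1) 0 0; rewrite scaler0 addr0 mulN1r addNr.
by rewrite -[a *: u]addr0 f_lin f0 addr0.
Qed.

(** Both sides are the value of [f] at the product of [u] and [v] in [A].  So
    a linear form on an ideal that contains a nonzerodivisor is multiplication
    by a fraction. *)
Lemma scalar_minorC (f : M -> A) (u v : M) : scalar f ->
  f u * minor_val v = f v * minor_val u.
Proof.
move=> f_lin; rewrite [LHS]mulrC [RHS]mulrC -!scalar_funZ //.
by congr f; apply: val_inj; exact: mulrC.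
Qed.

Lemma projective_dual_basis : projective M -> exists phi, dual_basis phi.
Proof.
pose comb (c : {ffun index -> A^o}) : M :=
  \sum_(I : index | #|I| == m) (c I : A) *: minor_elt I.
have comb_lin : linear comb.
  move=> a c e; rewrite /comb scaler_sumr -big_split /=; apply: eq_bigr => I _.
  by rewrite !ffunE scalerDl scalerA.
have [g gE] := linear_funP comb_lin.
move=> /(_ _ _ g idfun)[v | h hP].
  have [c ->] := minor_ideal_spanP v; exists [ffun I => c I].
  by rewrite gE; apply: eq_bigr => I _; rewrite ffunE.
exists (fun I v => h v I); split=> [I a u v | v].
  by rewrite linearP !ffunE.
by rewrite -[LHS]/(idfun v) -hP gE.
Qed.

Lemma dual_basis_projective phi : dual_basis phi -> projective M.
Proof.
move=> [phi_lin phiP] X Y g f g_surj.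
have [z zE] := choice (fun I => g_surj (f (minor_elt I))).
pose h v := \sum_(I : index | #|I| == m) phi I v *: z I.
have h_lin : linear h.
  move=> a u v; rewrite /h scaler_sumr -big_split /=; apply: eq_bigr => I _.
  by rewrite phi_lin scalerDl scalerA.
have [h' h'E] := linear_funP h_lin; exists h' => v.
rewrite h'E [in RHS](phiP v) !linear_sum; apply: eq_bigr => I _.
by rewrite !linearZ /= zE.
Qed.

(** The relation [\sum_I x_I t_I = 1] of an invertible ideal, obtained by
    cancelling a nonzerodivisor of the ideal. *)
Lemma dual_basis_trace phi (v : M) : GRing.lreg (minor_val v) ->
  dual_basis phi -> \sum_(I : index | #|I| == m) phi I (minor_elt I) = 1.
Proof.
move=> v_reg [phi_lin phiP]; apply: v_reg; rewrite mulr1 mulrC mulr_suml.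
rewrite [RHS](congr1 (@minor_val _ _ _ _) (phiP v)) minor_val_sum.
by apply: eq_bigr => I _; rewrite minor_valZ scalar_minorC.
Qed.

(** As the [phi I] of [t_I] add up to 1, one of them, [s], is outside [p].  The
    identity [s *: w = phi I w *: t_I] shows that [t_I] generates the ideal
    once [s] is inverted, and [phi I t_I = s] shows that it has no torsion. *)
Lemma dual_basis_rank1 phi (v : M) : GRing.lreg (minor_val v) ->
  dual_basis phi -> of_rank1 M.
Proof.
move=> v_reg phi_dual p B iota L f [iota_unit iota_frac _] [f_frac f_ker].
have [I pI] : exists I, phi I (minor_elt I) \notin p.
  apply: contrapT => noI; have /negP[] := negbT (idealr1 p).
  rewrite -(dual_basis_trace v_reg phi_dual); apply: rpred_sum => I _.
  by apply: contrapT => /negP pI; apply: noI; exists I.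
have [phi_lin _] := phi_dual.
pose t := minor_elt I; set s := phi I t in pI.
have st (w : M) : s *: w = phi I w *: t.
  by apply: val_inj; apply: scalar_minorC.
pose g (r : 'rV[B]_1) : L := r 0 0 *: f t.
have g_lin : linear g by move=> a x y; rewrite /g !mxE scalerDl scalerA.
have [h hE] := linear_funP g_lin; exists h.
have h_inj : injective h.
  suff ker0 x : h x = 0 -> x = 0.
    by move=> x y hxy; apply/subr0_eq/ker0; rewrite linearB /= hxy subrr.
  rewrite hE /g => xt0.
  apply/rowP=> j; rewrite ord1 mxE.
  have [a [u [pu xE]]] := iota_frac (x 0 0); rewrite xE in xt0 *.
  have fat0 : f (a *: t) = 0.
    rewrite linearZ /= -(scaler0 _ (iota u)) -xt0 scalerA mulrCA divrr.
      by rewrite mulr1.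
    exact: iota_unit.
  have [w [pw wat0]] := f_ker _ fat0.
  have was0 : iota (w * a * s) = 0.
    rewrite /s -scalar_funZ // -scalerA wat0.
    by rewrite -[0](scale0r t) scalar_funZ // mul0r rmorph0.
  have [w_unit s_unit] := (iota_unit w pw, iota_unit s pI).
  rewrite !rmorphM in was0.
  suff -> : iota a = 0 by rewrite mul0r.
  by apply/(mulrI w_unit)/(mulIr s_unit); rewrite was0 mulr0 mul0r.
have h_surj l : exists r, h r = l.
  have [w [u [pu ->]]] := f_frac l.
  exists (const_mx (iota (phi I w) / (iota u * iota s))); rewrite hE /g mxE.
  have [u_unit s_unit] := (iota_unit u pu, iota_unit s pI).
  have : iota s *: f w = iota (phi I w) *: f t by rewrite -!linearZ /= st.
  rewrite mulrC -scalerA => <-; rewrite scalerA invrM //.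
  by rewrite [_ * iota s]mulrC mulVKr.
have [h' h'K] := choice h_surj.
by exists h' => // x; apply: h_inj.
Qed.

End DualBasis.

(** * Keeping a determinant outside a prime ideal *)

(** Start from [X + Y] and change the coefficients of the rows of [Y] from [1]
    to [0] or [b], one row at a time.  The determinant is an affine function
    [u + e v] of the coefficient [e] of a row.  If [u] is outside [Z], take
    [e = 0]; otherwise [v] is outside [Z], as the determinant was, so that
    [u + b v] is outside the prime ideal [Z]. *)
Lemma avoid_prime_det (A : comNzRingType) (Z : prime_idealr A) m (b : A)
    (X Y : 'M[A]_m) : b \notin Z -> \det (X + Y) \notin Z ->
  exists q : 'rV[A]_m, \det (X + b *: diag_mx q *m Y) \notin Z.
Proof.
move=> Zb ZXY; pose mx (c : 'I_m -> A) := \matrix_(i, j) (X i j + c i * Y i j).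
pose coef (s : seq 'I_m) (q : 'I_m -> A) i := if i \in s then b * q i else 1.
suff rows s : exists q, \det (mx (coef s q)) \notin Z.
  have [q Zq] := rows (enum 'I_m); exists (\row_i q i).
  rewrite (_ : X + _ = mx (coef (enum 'I_m) q)) //; apply/matrixP=> i j.
  by rewrite -scalemxAl mul_diag_mx !mxE /coef mem_enum mulrA.
elim: s => [|k s [q Zq]].
  exists (fun=> 0); rewrite (_ : mx _ = X + Y) //.
  by apply/matrixP=> i j; rewrite !mxE mul1r.
pose upd e i := if i == k then e else coef s q i.
have updE e : mx (upd (b * e)) =
    mx (coef (k :: s) (fun i => if i == k then e else q i)).
  apply/matrixP=> i j; rewrite !mxE /upd /coef in_cons.
  by case: eqP.
pose Yk := \matrix_(i, j) if i == k then Y i j else mx (coef s q) i j.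
have det_upd e : \det (mx (upd e)) = \det (mx (upd 0)) + e * \det Yk.
  rewrite -[\det (mx (upd 0))]mul1r; apply: (determinant_multilinear (i0 := k)).
  - by apply/rowP=> j; rewrite !mxE /upd eqxx mul0r addr0 mul1r.
  - by apply/matrixP=> i j; rewrite !mxE /upd eq_sym (negPf (neq_lift _ _)).
  - by apply/matrixP=> i j; rewrite !mxE /upd eq_sym (negPf (neq_lift _ _)).
have [Z0 | Z0] := boolP (\det (mx (upd 0)) \in Z); last first.
  by exists (fun i => if i == k then 0 else q i); rewrite -updE mulr0.
exists (fun i => if i == k then 1 else q i); rewrite -updE mulr1 det_upd.
rewrite rpredDl // prime_idealrM negb_or Zb /=.
apply: contra Zq => ZYk.
rewrite (_ : mx _ = mx (upd (coef s q k))); last first.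
  by apply/matrixP=> i j; rewrite !mxE /upd; case: eqP => // ->.
by rewrite det_upd rpredD // prime_idealrM ZYk orbT.
Qed.

(** * Stabilizability as a factorization over the base ring *)

Lemma mulmx1_invmx (F : comUnitRingType) k (X Y : 'M[F]_k) :
  X *m Y = 1%:M -> X \in unitmx /\ invmx X = Y.
Proof.
move=> XY1; have [X_unit _] := mulmx1_unit XY1; split=> //.
by rewrite -[invmx X]mulmx1 -XY1 mulmxA mulVmx // mul1mx.
Qed.

Section Plants.

Variables (A : comNzRingType) (F : comUnitRingType) (iota : {rmorphism A -> F}).

Definition integral_mx p q (X : 'M[F]_(p, q)) : Prop :=
  exists X', X = map_mx iota X'.

Lemma integral_mxP p q (X : 'M[F]_(p, q)) :
  (forall i j, exists a, X i j = iota a) -> integral_mx X.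
Proof.
move=> X_int; have [f fP] := choice (fun ij => X_int ij.1 ij.2).
exists (\matrix_(i, j) f (i, j)); apply/matrixP=> i j.
by rewrite !mxE (fP (i, j)).
Qed.

Lemma map_full_size_minor n m (T : 'M[A]_(n + m, m)) I :
  full_size_minor (map_mx iota T) I = iota (full_size_minor T I).
Proof.
rewrite /full_size_minor -det_map_mx map_mxM; congr (\det (_ *m _)).
by apply/matrixP=> i j; rewrite !mxE rmorph_nat.
Qed.

Definition integral_factor n m (P : 'M[F]_(n, m)) (U : 'M[F]_m)
    (V : 'M[F]_(m, n)) : Prop :=
  U + V *m P = 1%:M /\
  [/\ integral_mx U, integral_mx V, integral_mx (P *m U)
    & integral_mx (P *m V)].

(** The dictionary is [U = (1 + CP)^-1], [V = U C] and, backwards,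
    [C = U^-1 V]; under it the closed loop is made of [1 - PV], [-PU], [V]
    and [U]. *)
Lemma stabilizableP n m (P : 'M[F]_(n, m)) :
  stabilizable iota P <->
  exists U V, integral_factor P U V /\ U \in unitmx.
Proof.
split=> [[C [PC_unit]] | [U [V [[UV1]]]]].
  set K := invmx (1%:M + P *m C); set L := invmx (1%:M + C *m P).
  move=> /integral_mxP[H HE].
  have PCK : P *m C *m K = 1%:M - K.
    by rewrite -[X in X - K](mulmxV PC_unit) mulmxDl mul1mx addrC addKr.
  have [CP_unit _] : 1%:M + C *m P \in unitmx /\ L = 1%:M - C *m K *m P.
    apply: mulmx1_invmx; rewrite mulmxDl mul1mx mulmxBr mulmx1.
    rewrite -!mulmxA (mulmxA P C) (mulmxA (P *m C) K) PCK mulmxBl mul1mx.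
    by rewrite mulmxBr opprB [X in _ + X]addrC !subrK.
  have CK : C *m K = L *m C.
    rewrite -[C *m K]mul1mx -(mulVmx CP_unit) -/L -mulmxA; congr (_ *m _).
    rewrite mulmxDl mul1mx -mulmxA [P *m _]mulmxA PCK mulmxBr mulmx1.
    by rewrite addrC subrK.
  exists L, (C *m K); split; last by rewrite unitmx_inv.
  have := congr1 ulsubmx HE; have := congr1 ursubmx HE.
  have := congr1 dlsubmx HE; have := congr1 drsubmx HE.
  rewrite /closed_loop block_mxKul block_mxKur block_mxKdl block_mxKdr.
  rewrite -!map_ulsubmx -!map_ursubmx -!map_dlsubmx -!map_drsubmx -/K -/L.
  move=> LE CKE PLE KE; split.
    by rewrite CK -mulmxA -[X in X + _]mulmx1 -mulmxDr mulVmx.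
  split; [by eexists; exact: LE | by eexists; exact: CKE | |].
    by exists (- ursubmx H); rewrite map_mxN -PLE opprK.
  exists (1%:M - ulsubmx H).
  by rewrite mulmxA PCK KE map_mxB map_mx1.
move=> [[U' UE] [V' VE] [PU PUE] [PV PVE]] U_unit.
exists (invmx U *m V).
have [_ L_U] : 1%:M + invmx U *m V *m P \in unitmx /\
    invmx (1%:M + invmx U *m V *m P) = U.
  apply: mulmx1_invmx; rewrite -[X in X + _](mulVmx U_unit) -mulmxA -mulmxDr.
  by rewrite UV1 mulmx1 mulVmx.
have VP : V *m P = 1%:M - U by rewrite -UV1 addrC addKr.
have [PC_unit K_PV] : 1%:M + P *m (invmx U *m V) \in unitmx /\
    invmx (1%:M + P *m (invmx U *m V)) = 1%:M - P *m V.
  apply: mulmx1_invmx; rewrite mulmxDl mul1mx mulmxBr mulmx1.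
  rewrite -!mulmxA (mulmxA V P) VP mulmxBl mul1mx !mulmxBr mulKmx //.
  by rewrite opprB [X in _ + X]addrC !subrK.
split=> // i j; have -> : closed_loop P (invmx U *m V) =
    map_mx iota (block_mx (1%:M - PV) (- PU) V' U').
  rewrite map_block_mx map_mxB map_mx1 map_mxN -UE -VE -PUE -PVE.
  rewrite /closed_loop L_U K_PV; congr block_mx.
  rewrite mulmxBr mulmx1 -!mulmxA (mulmxA V P) VP mulmxBl mul1mx mulmxBr.
  by rewrite mulKmx // opprB addrC subrK.
by rewrite mxE; eexists.
Qed.

(** The correspondence is [Y = D^-1 [V U]].  Since [T = [P; 1] D], it gives
    [Y T = D^-1 (V P + U) D], and [T Y = [P; 1] [V U]] has the four blocks
    [PV], [PU], [V], [U]. *)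
Lemma integral_factor_left_inverse n m (P : 'M[F]_(n, m))
    (N : 'M[A]_(n, m)) (D : 'M[A]_m) :
  map_mx iota D \in unitmx -> P = map_mx iota N *m invmx (map_mx iota D) ->
  let T := map_mx iota (col_mx N D) in
  (exists U V, integral_factor P U V) <->
  (exists Y, Y *m T = 1%:M /\ integral_mx (T *m Y)).
Proof.
move=> D_unit PE /=; rewrite map_col_mx; set Nf := map_mx iota N in PE *.
set Df := map_mx iota D in D_unit PE *.
have PD : P *m Df = Nf by rewrite PE mulmxKV.
split=> [[U [V [UV1 [[U' UE] [V' VE] [PU PUE] [PV PVE]]]]] | [Y [YT [E TY]]]].
  exists (invmx Df *m row_mx V U); split.
    rewrite -mulmxA mul_row_col -PD mulmxA -mulmxDl addrC UV1 mul1mx.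
    by rewrite mulVmx.
  exists (block_mx PV PU V' U').
  rewrite mul_col_mx mulmxA -PE mulmxA mulmxV // mul1mx mul_mx_row.
  by rewrite map_block_mx -UE -VE -PUE -PVE.
have YE : Y = row_mx (lsubmx Y) (rsubmx Y) by rewrite hsubmxK.
move: TY; rewrite YE mul_col_row => TY.
have := congr1 ulsubmx TY; have := congr1 ursubmx TY.
have := congr1 dlsubmx TY; have := congr1 drsubmx TY.
rewrite block_mxKul block_mxKur block_mxKdl block_mxKdr.
rewrite -!map_ulsubmx -!map_ursubmx -!map_dlsubmx -!map_drsubmx.
move=> DY2 DY1 NY2 NY1.
exists (Df *m rsubmx Y), (Df *m lsubmx Y); split.
  move: YT; rewrite {1}YE mul_row_col PE => YT.
  rewrite -[Df *m rsubmx Y]mulmx1 -(mulmxV D_unit) !mulmxA -mulmxDl.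
  by rewrite -!mulmxA -mulmxDr addrC YT mulmx1 mulmxV.
split; first by eexists; exact: DY2.
- by eexists; exact: DY1.
- by rewrite mulmxA PD; eexists; exact: NY2.
- by rewrite mulmxA PD; eexists; exact: NY1.
Qed.

(** * Left inverses and dual bases *)

(** The forms are the multiplications by the maximal minors [y I] of [Y].  They
    take values in [A], because the product of a minor of [T] with one of [Y]
    is a minor of [T Y]; Cauchy-Binet for [Y T = 1] is the dual basis
    relation. *)
Lemma left_inverse_dual_basis n m (T : 'M[A]_(n + m, m)) :
  injective iota ->
  (exists Y, Y *m map_mx iota T = 1%:M /\ integral_mx (map_mx iota T *m Y)) ->
  exists phi, dual_basis (T := T) phi.
Proof.
move=> iota_inj [Y [YT [E TY]]].
pose y I := \det (Y *m (Delta F I)^T).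
have y_int I : exists f : minor_ideal_module T -> A,
    forall v, iota (f v) = y I * iota (minor_val v).
  suff y_intv (v : minor_ideal_module T) :
      exists a, iota a = y I * iota (minor_val v).
    by have [f fP] := choice y_intv; exists f.
  case: v => v /= /asboolP[c ->].
  pose e J := \det (Delta A J *m E *m (Delta A I)^T).
  exists (\sum_(J : {set 'I_(n + m)} | #|J| == m) c J * e J).
  rewrite !rmorph_sum mulr_sumr; apply: eq_bigr => J _.
  rewrite !rmorphM /= mulrCA; congr (_ * _).
  rewrite -map_full_size_minor /full_size_minor /y mulrC -det_mulmx.
  rewrite -det_map_mx !map_mxM -TY -map_trmx; congr (\det _).
  have DE K : map_mx iota (Delta A K) = Delta F K.
    by apply/matrixP=> i j; rewrite !mxE rmorph_nat.
  by rewrite !DE !mulmxA.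
have [phi phiP] := choice y_int.
exists phi; split=> [I a u v | v].
  apply: iota_inj; rewrite phiP minor_valD minor_valZ !rmorphD !rmorphM /=.
  by rewrite !phiP mulrDr mulrCA.
apply: val_inj; apply: iota_inj.
rewrite /= minor_val_sum -[iota _]mul1r -(det1 F m) -YT Cauchy_Binet.
rewrite mulr_suml rmorph_sum; apply: eq_bigr => I /eqP cardI.
rewrite minor_valZ minor_eltK // rmorphM phiP map_full_size_minor.
by rewrite mulrAC.
Qed.

(** If [T_I] denotes the rows of [T] in [I], then [\adj T_I *m T_I] is the
    scalar matrix [t_I]; weighting these by the fractions [x I] that represent
    the forms [phi I] yields a left inverse of [T]. *)
Lemma dual_basis_left_inverse n m (T : 'M[A]_(n + m, m)) phi
    (d : minor_ideal_module T) :
  iota (minor_val d) \is a GRing.unit ->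
  GRing.lreg (minor_val d) -> dual_basis (T := T) phi ->
  exists Y, Y *m map_mx iota T = 1%:M /\ integral_mx (map_mx iota T *m Y).
Proof.
move=> d_unit d_reg phi_dual; have [phi_lin _] := phi_dual.
pose x I := iota (phi I d) / iota (minor_val d).
have xP I v : x I * iota (minor_val v) = iota (phi I v).
  apply: (mulIr d_unit); rewrite mulrAC /x divrK // -!rmorphM.
  by rewrite scalar_minorC.
pose adjT I := \adj (rowsub (select I) T) *m Delta A I.
exists (\sum_(I : {set 'I_(n + m)} | #|I| == m) x I *: map_mx iota (adjT I)).
split.
  rewrite mulmx_suml -[RHS]scalemx1 -[X in X *: _](rmorph1 iota).
  rewrite -(dual_basis_trace d_reg phi_dual) rmorph_sum scaler_suml.
  apply: eq_bigr => I /eqP cardI.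
  rewrite -scalemxAl -map_mxM /adjT -mulmxA Delta_mul // mul_adj_mx.
  rewrite map_scalar_mx -scalemx1 scalerA; congr (_ *: _).
  by rewrite -xP minor_eltK // full_size_minorE.
pose G I := \matrix_(i, k)
  phi I (in_minor_ideal T ((T *m \adj (rowsub (select I) T)) i k)).
exists (\sum_(I : {set 'I_(n + m)} | #|I| == m) G I *m Delta A I).
rewrite mulmx_sumr raddf_sum; apply: eq_bigr => I _ /=.
rewrite -scalemxAr -map_mxM /adjT mulmxA.
rewrite [in LHS]map_mxM [in RHS]map_mxM scalemxAl.
congr (_ *m _); apply/matrixP=> i k.
by rewrite 2![in RHS]mxE -xP in_minor_idealK ?mulmx_adj_rowsub_in // !mxE.
Qed.

(** * Using causality to reach an invertible factor *)

Lemma causal_common_denominator (Z : prime_idealr A) n m (P : 'M[F]_(n, m)) :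
  (forall b, b \notin Z -> iota b \is a GRing.unit) -> causal_mx iota Z P ->
  exists b, b \notin Z /\ integral_mx (iota b *: P).
Proof.
move=> Z_unit P_causal.
have [a aP] := choice (fun ij => P_causal ij.1 ij.2).
have [b bP] := choice aP.
exists (\prod_ij b ij); split.
  apply: (big_ind (fun x => x \notin Z)) => [|x y Zx Zy | ij _].
  - by rewrite idealr1.
  - by rewrite prime_idealrM negb_or Zx.
  - by have [] := bP ij.
apply: integral_mxP => i j; have [Zb PE] := bP (i, j).
exists (a (i, j) * \prod_(ij | ij != (i, j)) b ij).
rewrite mxE PE (bigD1 (i, j)) //= !rmorphM /= mulrAC mulrCA.
by rewrite divrr ?Z_unit // mulr1 mulrC.
Qed.

(** With [b] a common denominator of [P] and [Q] over [A], the replacement of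
    [(U, V)] by [(U + bQ(1 - U), V - bQV)] preserves [U + VP = 1], as
    [VP = 1 - U], and keeps [PU] and [PV] over [A], as [bP] is.  Since
    [U + (1 - U) = 1] has determinant [1], some diagonal [Q] brings the
    determinant of the first factor outside [Z]. *)
Lemma causal_integral_factor_unit (Z : prime_idealr A) n m
    (P : 'M[F]_(n, m)) (U : 'M[F]_m) (V : 'M[F]_(m, n)) :
  (forall b, b \notin Z -> iota b \is a GRing.unit) -> causal_mx iota Z P ->
  integral_factor P U V ->
  exists U' V', integral_factor P U' V' /\ U' \in unitmx.
Proof.
move=> Z_unit P_causal [UV1 [[U0 UE] [V0 VE] [PU PUE] [PV PVE]]].
have [b [Zb [bP bPE]]] := causal_common_denominator Z_unit P_causal.
have [|q Zq] := @avoid_prime_det A Z m b U0 (1%:M - U0) Zb.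
  by rewrite addrC subrK det1 idealr1.
pose Q := map_mx iota (diag_mx q).
pose U1 := U + iota b *: Q *m (1%:M - U).
have U1E : U1 = map_mx iota (U0 + b *: diag_mx q *m (1%:M - U0)).
  by rewrite /U1 UE map_mxD map_mxM map_mxZ map_mxB map_mx1.
have VP : V *m P = 1%:M - U by rewrite -UV1 addrC addKr.
have PQ : P *m (iota b *: Q) = map_mx iota (bP *m diag_mx q).
  by rewrite map_mxM -bPE -scalemxAl scalemxAr.
exists U1, (V - iota b *: Q *m V); split; last first.
  by rewrite unitmxE U1E det_map_mx Z_unit.
split; first by rewrite mulmxBl -mulmxA VP /U1 addrACA subrr addr0 addrC subrK.
split.
- by rewrite U1E; eexists.
- exists (V0 - b *: diag_mx q *m V0).
  by rewrite VE map_mxB map_mxM map_mxZ.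
- exists (PU + bP *m diag_mx q *m (1%:M - U0)).
  by rewrite map_mxD -PUE map_mxM -PQ map_mxB map_mx1 -UE mulmxDr !mulmxA.
- exists (PV - bP *m diag_mx q *m V0).
  by rewrite map_mxB -PVE map_mxM -PQ -VE mulmxBr !mulmxA.
Qed.

End Plants.

Lemma total_fraction_inj (A : comNzRingType) (F : comUnitRingType)
  (iota : {rmorphism A -> F}) : is_total_fraction_ring iota -> injective iota.
Proof.
move=> [_ _ ker] a b ab; apply: subr0_eq.
have [|s [s_reg]] := ker (a - b); first by rewrite rmorphB ab subrr.
by move=> s0; apply: s_reg; rewrite s0 mulr0.
Qed.

(** * The theorem *)

Theorem theorem5p2 (A : comNzRingType) (F : comUnitRingType)
    (iota : {rmorphism A -> F}) (hF : is_total_fraction_ring iota)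
    (Z : prime_idealr A) (hZ : forall a : A, ~ GRing.lreg a -> a \in Z)
    (m n : nat) (hm : (0 < m)%N) (hn : (0 < n)%N)
    (P : 'M[F]_(n, m)) (hP : causal_mx iota Z P)
    (N : 'M[A]_(n, m)) (D : 'M[A]_m)
    (hND : fractional_representation iota P N D) :
  (stabilizable iota P <-> projective (minor_ideal_module (col_mx N D)))
  /\ (projective (minor_ideal_module (col_mx N D)) ->
      of_rank1 (minor_ideal_module (col_mx N D))).
Proof.
have [D_reg PE] := hND; have [iota_unit _ _] := hF.
have iota_inj := total_fraction_inj hF.
have Z_unit b : b \notin Z -> iota b \is a GRing.unit.
  by move=> Zb; apply: iota_unit; apply: contrapT => /hZ; apply/negP.
have D_unit : map_mx iota D \in unitmx by rewrite unitmxE det_map_mx iota_unit.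
pose d := in_minor_ideal (col_mx N D) (\det D).
have dE : minor_val d = \det D.
  apply: in_minor_idealK.
  have -> : \det D = \det (rowsub (@rshift n m) (col_mx N D)).
    by congr (\det _); apply/matrixP=> i j; rewrite mxE col_mxEd.
  exact: det_rowsub_in.
have d_reg : GRing.lreg (minor_val d) by rewrite dE.
have factorP := integral_factor_left_inverse D_unit PE.
split; last first.
  move=> /projective_dual_basis[phi phiP].
  exact: dual_basis_rank1 d_reg phiP.
split=> [/stabilizableP[U [V [UV _]]] | /projective_dual_basis[phi phiP]].
  have [|phi phiP] := @left_inverse_dual_basis _ _ _ _ _ (col_mx N D) iota_inj.
    by apply/factorP; exists U, V.
  exact: dual_basis_projective phiP.
have [|U [V UV]] := (factorP.2 _).
  by apply: dual_basis_left_inverse d_reg phiP; rewrite // dE iota_unit.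
exact/stabilizableP/(causal_integral_factor_unit Z_unit hP UV).
Qed.
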